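(* Let $(V_1,V_2)$ be a pair of commuting isometries on a Hilbert space $\mathcal H$ with $C(V_1,V_2)\ge0$ and $C(V_1,V_2)\neq0$. Then $\sigma(V_1,V_2)=\overline{\mathbb D^2}$ and every point $(w_1,w_2)\in\mathbb D^2$ is a joint eigenvalue of $(V_1^*,V_2^* )$. In particular, for every $(w_1,w_2)\in\mathbb D^2$, the non-singularity of the Koszul complex of $(V_1-w_1I,V_2-w_2I)$ is broken at the third stage.
   Context: Defect operator: $C(V_1,V_2)=I-V_1V_1^*-V_2V_2^*+V_1V_2V_2^*V_1^*$. For commuting bounded operators $T_1,T_2$ on $\mathcal H$, the Koszul complex is $0\xrightarrow{\delta_0}\mathcal H\xrightarrow{\delta_1}\mathcal H\oplus\mathcal H\xrightarrow{\delta_2}\mathcal H\xrightarrow{\delta_3}0$ with $\delta_1h=(T_1h,T_2h)$, $\delta_2(h_1,h_2)=T_1h_2-T_2h_1$; $\sigma(T_1,T_2)$ (Taylor joint spectrum) is the set of $(\lambda_1,\lambda_2)$ for which the complex of $(T_1-\lambda_1I,T_2-\lambda_2I)$ is not exact. The non-singularity breaks at stage $n$ if $\operatorname{ran}\delta_{n-1}\ne\ker\delta_n$; breaking at stage 3 means $\operatorname{ran}T_1+\operatorname{ran}T_2\neq\mathcal H$. *)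

(* Defs.v *)
(* complex scalars R[i] (mathcomp-real-closed) over a realType R. *)
From mathcomp Require Import all_boot all_algebra.
From mathcomp Require Import complex reals.
From mathcomp Require Import classical_sets.
Import GRing.Theory Num.Theory.
Local Open Scope ring_scope.
Local Open Scope classical_set_scope.

Set Implicit Arguments.
Unset Strict Implicit.
Unset Printing Implicit Defensive.

Section Hilbert.
Variable R : realType.
Variable H : lmodType R[i].
(* the inner product, linear in the first argument *)
Variable ip : H -> H -> R[i].

(* ip is an inner product and H is complete for the induced norm,
   i.e. (H, ip) is a complex Hilbert space.  Squared norms ip x x are used
   in the Cauchy / convergence conditions (equivalent to using norms). *)
Definition hilbert_space : Prop :=
  [/\ (forall a x y z, ip (a *: x + y) z = a * ip x z + ip y z),
      (forall x y, ip y x = (ip x y)^*),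
      (forall x, 0 <= ip x x),
      (forall x, ip x x = 0 -> x = 0) &
      (forall u : nat -> H,
         (forall e : R[i], 0 < e -> exists N : nat, forall m n : nat,
            (N <= m)%N -> (N <= n)%N -> ip (u m - u n) (u m - u n) < e) ->
         exists l : H, forall e : R[i], 0 < e -> exists N : nat,
            forall n : nat, (N <= n)%N -> ip (u n - l) (u n - l) < e)].

(* bounded linear operator *)
Definition bounded_op (T : H -> H) : Prop :=
  (forall a x y, T (a *: x + y) = a *: T x + T y) /\
  exists M : R[i], forall x, ip (T x) (T x) <= M * ip x x.

(* Ts is the Hilbert-space adjoint T^* of T *)
Definition is_adjoint (T Ts : H -> H) : Prop :=
  forall x y, ip (T x) y = ip x (Ts y).

(* isometry: bounded linear with ||Vx|| = ||x|| *)
Definition isometry_op (V : H -> H) : Prop :=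
  bounded_op V /\ forall x, ip (V x) (V x) = ip x x.

(* defect operator C(V1,V2) = I - V1V1^* - V2V2^* + V1V2V2^*V1^* *)
Definition defect (V1 V2 V1s V2s : H -> H) : H -> H :=
  fun x => x - V1 (V1s x) - V2 (V2s x) + V1 (V2 (V2s (V1s x))).

(* positivity of an operator: <A x, x> >= 0 *)
Definition positive_op (A : H -> H) : Prop := forall x, 0 <= ip (A x) x.

(* Koszul complex of (T1,T2):
   0 -> H -d1-> H + H -d2-> H -> 0 *)
Definition koszul_d1 (T1 T2 : H -> H) (h : H) : H * H := (T1 h, T2 h).
Definition koszul_d2 (T1 T2 : H -> H) (p : H * H) : H := T1 p.2 - T2 p.1.

(* non-singularity of the Koszul complex of (T1,T2) breaks at stage n,
   i.e. ran d_{n-1} <> ker d_n (with d_0 = 0 and d_3 = 0). *)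
Definition koszul_breaks_at (T1 T2 : H -> H) (n : nat) : Prop :=
  match n with
  | 1%N => [set 0 : H] <> koszul_d1 T1 T2 @^-1` [set (0 : H, 0 : H)]
  | 2%N => range (koszul_d1 T1 T2) <> koszul_d2 T1 T2 @^-1` [set 0 : H]
  | 3%N => range (koszul_d2 T1 T2) <> [set: H]
  | _ => False
  end.

Definition koszul_exact (T1 T2 : H -> H) : Prop :=
  forall n, ~ koszul_breaks_at T1 T2 n.

Definition shift (T : H -> H) (w : R[i]) : H -> H := fun x => T x - w *: x.

(* Taylor joint spectrum *)
Definition taylor_spectrum (T1 T2 : H -> H) : set (R[i] * R[i]) :=
  [set w | ~ koszul_exact (shift T1 w.1) (shift T2 w.2)].

(* joint eigenvalue of (A1, A2) *)
Definition joint_eigenvalue (A1 A2 : H -> H) (w : R[i] * R[i]) : Prop :=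
  exists x : H, x <> 0 /\ A1 x = w.1 *: x /\ A2 x = w.2 *: x.

End Hilbert.

Definition closed_bidisk (R : realType) : set (R[i] * R[i]) :=
  [set w | `|w.1| <= 1 /\ `|w.2| <= 1].
Definition open_bidisk (R : realType) : set (R[i] * R[i]) :=
  [set w | `|w.1| < 1 /\ `|w.2| < 1].

(* Main.v *)
(* Positivity of the defect makes V1 commute with the adjoint of V2 and conversely, so the
   range of the defect operator is killed by both adjoints, and a nonzero vector [e] of it
   spreads to the joint eigenvectors [(1 - w1 V1)^-1 (1 - w2 V2)^-1 e] of the adjoints over
   the open bidisk.  At a point [w] of the closed bidisk, unit eigenvectors at points
   tending to [w^*] show that the adjoint of the last Koszul map is not bounded below, so
   by a gliding-hump argument that map is not onto.  Outside the closed bidisk one of the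
   [Vi - wi] is invertible, which makes the Koszul complex exact. *)
Require Import Defs.
From mathcomp Require Import all_boot all_order all_algebra.
From mathcomp Require Import boolp complex reals.
From mathcomp Require Import classical_sets.
From mathcomp Require Import ring lra.
Import Order.TTheory GRing.Theory Num.Theory ComplexField.Normc.
Set Implicit Arguments.
Unset Strict Implicit.
Unset Printing Implicit Defensive.
Local Open Scope ring_scope.
Local Open Scope classical_set_scope.

(** * Geometric decay in a real field *)

Lemma geometric_lt (R : realType) (K r e : R) :
  0 <= K -> 0 <= r < 1 -> 0 < e ->
  exists N : nat, forall n, (N <= n)%N -> K * r ^+ n < e.
Proof.
move=> K0 /andP[r0 r1] e0.
have rn0 n : 0 <= r ^+ n by exact: exprn_ge0.
(* This is [1 - r] times the bound of [1 + r + ... + r ^+ n] from below by [n.+1] copies of its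
   least term [r ^+ n]; hence [r ^+ n] decays at least like [1 / n]. *)
have bern n : n.+1%:R * (1 - r) * r ^+ n <= 1 - r ^+ n.+1.
  elim: n => [|n IHn]; first by rewrite expr0 expr1 mul1r mulr1.
  have := rn0 n.+1; have := exprn_ile1 n.+1 r0 (ltW r1).
  move: IHn; rewrite -[n.+2%:R]natr1 !exprS; move: (rn0 n) (n.+1%:R) => p0 m.
  by move: (r ^+ n) p0 => p p0; nra.
have [N KN] : exists N : nat, K / (e * (1 - r)) < N%:R.
  by exists (Num.bound (K / (e * (1 - r)))); apply: archi_boundP;
    rewrite divr_ge0 // mulr_ge0 // ltW // subr_gt0.
exists N => n Nn.
have d0 : 0 < e * (1 - r) by rewrite mulr_gt0 // subr_gt0.
have Kn : K < n.+1%:R * (e * (1 - r)).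
  rewrite -ltr_pdivrMr //; apply: (lt_le_trans KN).
  by rewrite ler_nat ltnW.
have [rn|rn] := eqVneq (r ^+ n) 0; first by rewrite rn mulr0.
have rnp : 0 < r ^+ n by rewrite lt_neqAle eq_sym rn rn0.
have H1 : K * r ^+ n < n.+1%:R * (e * (1 - r)) * r ^+ n by rewrite ltr_pM2r.
have := bern n; have := rn0 n.+1; move: H1; set m := n.+1%:R; set p := r ^+ n.
by move: (r ^+ n.+1) => p'; nra.
Qed.

Lemma geometric_le0 (R : realType) (K r x : R) :
  0 <= r < 1 -> (forall n, x <= K * r ^+ n) -> x <= 0.
Proof.
move=> r01 xK; rewrite leNgt; apply/negP => x0.
have K0 : 0 <= K by have := xK 0%N; rewrite expr0 mulr1; apply: le_trans; exact: ltW.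
have [N /(_ N (leqnn N))] := geometric_lt K0 r01 x0.
by rewrite ltNge xK.
Qed.

(** * Inner product, norm and completeness *)

Section Hilbert.
Variables (R : realType) (H : lmodType R[i]) (ip : H -> H -> R[i]).
Hypothesis hilb : hilbert_space ip.

Lemma ipDl x y z : ip (x + y) z = ip x z + ip y z.
Proof. by case: hilb => L _ _ _ _; rewrite -{1}[x]scale1r L mul1r. Qed.

Lemma ip0l z : ip 0 z = 0.
Proof. by apply: (addrI (ip 0 z)); rewrite -ipDl !addr0. Qed.

Lemma ipZl a x z : ip (a *: x) z = a * ip x z.
Proof. by case: hilb => L _ _ _ _; rewrite -[a *: x]addr0 L ip0l addr0. Qed.

Lemma ipNl x z : ip (- x) z = - ip x z.
Proof. by rewrite -scaleN1r ipZl mulN1r. Qed.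

Lemma ipBl x y z : ip (x - y) z = ip x z - ip y z.
Proof. by rewrite ipDl ipNl. Qed.

Lemma ipC x y : ip y x = (ip x y)^*.
Proof. by case: hilb. Qed.

Lemma ipDr x y z : ip z (x + y) = ip z x + ip z y.
Proof. by rewrite ipC ipDl rmorphD /= -!ipC. Qed.

Lemma ipZr a x z : ip z (a *: x) = a^* * ip z x.
Proof. by rewrite ipC ipZl rmorphM /= -ipC. Qed.

Lemma ipNr x z : ip z (- x) = - ip z x.
Proof. by rewrite ipC ipNl rmorphN /= -ipC. Qed.

Lemma ipBr x y z : ip z (x - y) = ip z x - ip z y.
Proof. by rewrite ipDr ipNr. Qed.

Lemma ip0r z : ip z 0 = 0.
Proof. by rewrite ipC ip0l rmorph0. Qed.

Lemma ip_ge0 x : 0 <= ip x x.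
Proof. by case: hilb. Qed.

Lemma ip_eq0 x : ip x x = 0 -> x = 0.
Proof. by case: hilb => _ _ _ h _; apply: h. Qed.

Lemma ip_inj x y : (forall z, ip z x = ip z y) -> x = y.
Proof.
by move=> xy; apply/subr0_eq/ip_eq0; rewrite ipBr xy subrr.
Qed.

(** A norm with values in [R] rather than [R[i]] keeps estimates within ordered-field arithmetic;
    taking the real part loses nothing, since [ip x x] is real. *)
Definition hnorm x : R := Num.sqrt (complex.Re (ip x x)).

Lemma hnorm_ge0 x : 0 <= hnorm x.
Proof. exact: sqrtr_ge0. Qed.

Lemma ip_hnorm x : ip x x = ((hnorm x) ^+ 2)%:C%C.
Proof.
have := ip_ge0 x; rewrite lecE /= => /andP[/eqP im re].
by rewrite sqr_sqrtr // [LHS]complexE im mulr0 addr0.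
Qed.

Lemma hnorm_eq x y : ip x x = ip y y -> hnorm x = hnorm y.
Proof. by rewrite /hnorm => ->. Qed.

Lemma hnorm_eq0 x : hnorm x = 0 -> x = 0.
Proof. by move=> x0; apply: ip_eq0; rewrite ip_hnorm x0 expr0n. Qed.

Lemma hnorm_le0 x : hnorm x <= 0 -> x = 0.
Proof. by move=> x0; apply/hnorm_eq0/le_anti; rewrite x0 hnorm_ge0. Qed.

Lemma hnorm0 : hnorm 0 = 0.
Proof. by rewrite /hnorm ip0l sqrtr0. Qed.

Lemma normc_ge0 (z : R[i]) : 0 <= normc z.
Proof. by case: z => a b; exact: sqrtr_ge0. Qed.

Lemma normC_normc (z : R[i]) : `|z| = (normc z)%:C%C.
Proof. by case: z. Qed.

Lemma hnormZ a x : hnorm (a *: x) = normc a * hnorm x.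
Proof.
apply/eqP; rewrite -(@eqrXn2 _ 2) ?hnorm_ge0 ?mulr_ge0 ?normc_ge0 ?hnorm_ge0 //.
apply/eqP/complexI; rewrite -ip_hnorm exprMn rmorphM /= -ip_hnorm.
by rewrite rmorphXn /= -normC_normc ipZl ipZr mulrA normCK.
Qed.

Lemma hnormN x : hnorm (- x) = hnorm x.
Proof. by apply: hnorm_eq; rewrite ipNl ipNr opprK. Qed.

Lemma hnormB x y : hnorm (x - y) = hnorm (y - x).
Proof. by rewrite -hnormN opprB. Qed.

Lemma cauchy_schwarz x y : normc (ip x y) <= hnorm x * hnorm y.
Proof.
have [->|y0] := eqVneq y 0; first by rewrite ip0r hnorm0 mulr0 normc0.
have b0 : 0 < ip y y.
  by rewrite lt_neqAle ip_ge0 andbT eq_sym; apply: contra y0 => /eqP/ip_eq0 ->.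
rewrite -(@ler_pXn2r _ 2) ?nnegrE ?mulr_ge0 ?hnorm_ge0 ?normc_ge0 //.
rewrite -lecR rmorphXn /= -normC_normc exprMn rmorphM /= -!ip_hnorm.
(* This vector is [ip y y] times the component of [x] orthogonal to [y]; its squared norm factors as
   [ip y y] times the gap in the squared inequality. *)
have := ip_ge0 (ip y y *: x - ip x y *: y).
rewrite ipBl !ipBr !ipZl !ipZr -(ipC y y) -!(ipC x y) normCK -ipC.
rewrite (_ : _ - _ = ip y y * (ip x x * ip y y - ip x y * ip y x)); last by ring.
by rewrite pmulr_rge0 // subr_ge0.
Qed.

Lemma hnormD x y : hnorm (x + y) <= hnorm x + hnorm y.
Proof.
rewrite -(@ler_pXn2r _ 2) ?nnegrE ?addr_ge0 ?hnorm_ge0 //.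
have e : (hnorm (x + y)) ^+ 2 =
    hnorm x ^+ 2 + hnorm y ^+ 2 + 2 * complex.Re (ip x y).
  apply: complexI; rewrite -ip_hnorm ipDl !ipDr !rmorphD /= -!ip_hnorm.
  rewrite rmorphM /= (ipC x y).
  suff -> : (2%:R)%:C%C * (complex.Re (ip x y))%:C%C = ip x y + (ip x y)^* :> R[i]
    by ring.
  by rewrite [RHS]addcJ rmorph_nat.
have := cauchy_schwarz x y.
have : complex.Re (ip x y) <= normc (ip x y).
  case: (ip x y) => a b /=; apply: (le_trans (ler_norm a)).
  by rewrite -sqrtr_sqr ler_wsqrtr // lerDl sqr_ge0.
by rewrite e; nra.
Qed.

Lemma hnorm_triangle x y z : hnorm (x - z) <= hnorm (x - y) + hnorm (y - z).
Proof. by rewrite -[x - z](subrKA y) hnormD. Qed.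

(** Summing the tail of the increments gives the Cauchy property, and the same bound passes to the
    limit. The explicit rate serves both the fixed-point iteration and the gliding hump. *)
Lemma geometric_cvg (c : nat -> H) (M r : R) :
  0 <= r < 1 -> (forall n, hnorm (c n.+1 - c n) <= M * r ^+ n) ->
  exists l, forall n, hnorm (l - c n) <= M / (1 - r) * r ^+ n.
Proof.
move=> r01 cM; have /andP[r0 r1] := r01.
have r1' : 0 < 1 - r by rewrite subr_gt0.
have M0 : 0 <= M.
  by apply: le_trans (hnorm_ge0 (c 1%N - c 0%N)) _; rewrite -[M]mulr1 -(expr0 r).
set K := M / (1 - r).
have K0 : 0 <= K by rewrite divr_ge0 // ltW.
have step k n : hnorm (c (n + k)%N - c n) <= K * r ^+ n.
  elim: k n => [|k IHk] n.
    by rewrite addn0 subrr hnorm0 mulr_ge0 // exprn_ge0.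
  apply: le_trans (hnorm_triangle _ (c n.+1) _) _.
  rewrite -addSnnS; apply: le_trans (lerD (IHk n.+1) (cM n)) _.
  by rewrite le_eqVlt; apply/orP; left; apply/eqP; rewrite /K exprS; field; lra.
have cauchy m n N : (N <= m)%N -> (N <= n)%N ->
    hnorm (c m - c n) <= 2 * K * r ^+ N.
  move=> Nm Nn; apply: le_trans (hnorm_triangle _ (c N) _) _.
  have := step (m - N)%N N; have := step (n - N)%N N.
  rewrite !subnKC // [in X in _ -> _ -> X](hnormB (c N)); lra.
(* Completeness is stated with squared norms and tolerances in [R[i]]; a positive such tolerance is
   real, hence the square of a real [d]. *)
have gt0c (e : R[i]) : 0 < e -> exists2 d : R, 0 < d & (d ^+ 2)%:C%C = e.
  rewrite ltcE /= => /andP[/eqP im re]; exists (Num.sqrt (complex.Re e)).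
    by rewrite sqrtr_gt0.
  by rewrite sqr_sqrtr ?ltW // [RHS]complexE im mulr0 addr0.
have ltq d x : 0 < d -> (ip x x < (d ^+ 2)%:C%C) = (hnorm x < d).
  by move=> d0; rewrite ip_hnorm ltcR ltr_pXn2r // ?nnegrE ?hnorm_ge0 // ltW.
have [_ _ _ _ /(_ c) complete] := hilb.
have [|l cl] := complete.
  move=> e /gt0c [d d0 <-].
  have [|N Nd] := geometric_lt (K := 2 * K) _ r01 d0; first by rewrite mulr_ge0.
  exists N => m n Nm Nn; rewrite ltq //.
  by apply: le_lt_trans (cauchy m n N Nm Nn) _; exact: Nd.
exists l => n; rewrite -/K.
apply/ler_addgt0Pr => e e0.
have [|N cN] := cl (e ^+ 2)%:C%C; first by rewrite ltcR exprn_gt0.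
have := cN _ (leq_addl n N); rewrite ltq // => ce.
(* The index [n + N] is past [N], so close to the limit, and past [n], so within reach of [step]. *)
apply: le_trans (hnorm_triangle _ (c (n + N)%N) _) _.
by rewrite (hnormB l) [leRHS]addrC lerD ?step // ltW.
Qed.

Lemma normC_lt1 (z : R[i]) : (`|z| < 1) = (normc z < 1).
Proof. by rewrite normC_normc -[1]/(1%:C%C) ltcR. Qed.

Lemma normC_le1 (z : R[i]) : (`|z| <= 1) = (normc z <= 1).
Proof. by rewrite normC_normc -[1]/(1%:C%C) lecR. Qed.

(** * Linear maps and adjoints *)

Section LinearMap.
Variables (T : H -> H) (linT : linear T).

Lemma lin_0 : T 0 = 0.
Proof. by apply: (addrI (T 0)); rewrite -{1}[T 0]scale1r -linT scaler0 !addr0. Qed.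

Lemma lin_D x y : T (x + y) = T x + T y.
Proof. by rewrite -{1}[x]scale1r linT scale1r. Qed.

Lemma lin_Z a x : T (a *: x) = a *: T x.
Proof. by rewrite -[a *: x]addr0 linT lin_0 addr0. Qed.

Lemma lin_B x y : T (x - y) = T x - T y.
Proof. by rewrite lin_D -scaleN1r lin_Z scaleN1r. Qed.

Lemma shift_linear w : linear (shift T w).
Proof.
move=> a x y; rewrite /shift linT scalerDr scalerBr !scalerA [a * w]mulrC.
by rewrite opprD addrACA.
Qed.

End LinearMap.

Lemma adjoint_linear T Ts : is_adjoint ip T Ts -> linear Ts.
Proof.
by move=> adj a x y; apply: ip_inj => z; rewrite -adj !ipDr !ipZr -!adj.
Qed.

Lemma adjoint_sym T Ts x y : is_adjoint ip T Ts -> ip (Ts x) y = ip x (T y).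
Proof. by move=> adj; rewrite (ipC y) -adj -ipC. Qed.

(** * A single isometry and its resolvent *)

Section Isometry.
Variables (V : H -> H) (isoV : isometry_op ip V).

Lemma isometry_linear : linear V.
Proof. by case: isoV => [[linV _] _]; exact: linV. Qed.

Lemma isometry_hnorm x : hnorm (V x) = hnorm x.
Proof. by apply: hnorm_eq; case: isoV. Qed.

(** Polarization: norm preservation at [x + a *: y] with [a = 1] kills the real part of the
    difference [d], and with [a = 'i] its imaginary part. *)
Lemma isometry_ip x y : ip (V x) (V y) = ip x y.
Proof.
have iso z : ip (V z) (V z) = ip z z by case: isoV.
set d := ip (V x) (V y) - ip x y.
have polar a : a^* * d + a * d^* = 0.
  rewrite /d rmorphB /= -!ipC.
  have := iso (x + a *: y).
  rewrite (lin_D isometry_linear) (lin_Z isometry_linear).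
  rewrite !(ipDl, ipDr) !(ipZl, ipZr) !iso => /eqP.
  by rewrite -subr_eq0 => /eqP <-; ring.
have d1 : d + d^* = 0 by have := polar 1; rewrite conjC1 !mul1r.
have d2 : d - d^* = 0.
  have := polar 'i; rewrite conjCi mulNr addrC -mulrBr => /eqP.
  by rewrite mulf_eq0 (negbTE (neq0Ci _)) /= subr_eq0 => /eqP ->; rewrite subrr.
apply/eqP; rewrite -subr_eq0 -/d.
have : 2 * d = 0 by rewrite -[RHS](addr0 0) -{1}d1 -d2; ring.
by move=> /eqP; rewrite mulf_eq0 pnatr_eq0.
Qed.

Lemma isometry_adjointK Vs : is_adjoint ip V Vs -> cancel V Vs.
Proof. by move=> adj x; apply: ip_inj => z; rewrite -adj isometry_ip. Qed.

(** The map [u |-> e + w *: V u] contracts distances by [normc w], so its iterates from 0 converge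
    to [y = (1 - w V)^-1 e]. *)
Lemma isometry_fixed_point (w : R[i]) e :
  normc w < 1 -> exists y, y = e + w *: V y.
Proof.
move=> w1.
have r01 : 0 <= normc w < 1 by rewrite normc_ge0.
pose c n := iter n (fun u => e + w *: V u) 0.
have step x y : hnorm ((e + w *: V x) - (e + w *: V y)) = normc w * hnorm (x - y).
  rewrite opprD addrACA subrr add0r -scalerBr -(lin_B isometry_linear).
  by rewrite hnormZ isometry_hnorm.
have c_geo n : hnorm (c n.+1 - c n) <= hnorm e * normc w ^+ n.
  elim: n => [|n IHn].
    by rewrite /c /= (lin_0 isometry_linear) scaler0 addr0 subr0 expr0 mulr1.
  by rewrite /c !iterS step exprS mulrCA ler_wpM2l ?normc_ge0.
have [l lc] := geometric_cvg r01 c_geo.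
set K := hnorm e / (1 - normc w) in lc.
exists l; apply/subr0_eq/hnorm_le0.
(* Going through the iterate [c n.+1], the distances from [l] to it and from it to the image of [l]
   are each at most [K * normc w ^+ n]. *)
apply: (@geometric_le0 _ (2 * K) _ _ r01) => n.
apply: le_trans (hnorm_triangle _ (c n.+1) _) _.
rewrite {2}/c iterS step (hnormB (iter n _ _)).
have := lc n; have := lc n.+1; have := hnorm_ge0 (l - c n).
rewrite exprS mulrCA -mulrA -/(c n); case/andP: r01.
move: (hnorm (l - c n)) (hnorm (l - c n.+1)) (K * normc w ^+ n) (normc w).
by move=> *; nra.
Qed.

Lemma isometry_fixed_eq0 (w : R[i]) z : normc w < 1 -> z = w *: V z -> z = 0.
Proof.
move=> w1 zw; apply: hnorm_le0.
have : hnorm z = normc w * hnorm z by rewrite {1}zw hnormZ isometry_hnorm.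
by have := hnorm_ge0 z; nra.
Qed.

(** Since [V - w = - w (1 - w^-1 V)] with [normc w^-1 < 1], the fixed-point lemmas apply at
    [w^-1]. *)
Lemma shift_isometry_bij (w : R[i]) : 1 < normc w ->
  injective (shift V w) /\ forall f, exists x, shift V w x = f.
Proof.
move=> w1.
have w0 : w != 0 by apply: contraTneq w1 => ->; rewrite normc0 ltr10.
have wV1 : normc w^-1 < 1 by rewrite normcV invf_lt1 // (lt_trans _ w1).
split=> [x y /eqP|f].
  rewrite -subr_eq0 -(lin_B (shift_linear isometry_linear w)) subr_eq0 => /eqP xy.
  apply/subr0_eq/(isometry_fixed_eq0 wV1).
  by rewrite xy scalerA mulVf // scale1r.
have [x xE] := isometry_fixed_point (- (w^-1 *: f)) wV1.
exists x; rewrite /shift [X in w *: X]xE scalerDr scalerN !scalerA divff //.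
by rewrite !scale1r opprD opprK addrCA subrr addr0.
Qed.

End Isometry.

(** * Exactness of the Koszul complex *)

Section KoszulComplex.
Variables T1 T2 : H -> H.
Hypotheses (lin1 : linear T1) (lin2 : linear T2).
Hypothesis comm : forall x, T1 (T2 x) = T2 (T1 x).

(** The inclusions of kernels in ranges are the ones to supply; the converse ones follow from
    linearity and [comm]. *)
Lemma koszul_exact_intro :
  (forall h, T1 h = 0 -> T2 h = 0 -> h = 0) ->
  (forall h1 h2, T1 h2 = T2 h1 -> exists h, T1 h = h1 /\ T2 h = h2) ->
  (forall f, exists a b, T1 a - T2 b = f) ->
  koszul_exact T1 T2.
Proof.
move=> ex1 ex2 ex3 [|[|[|[|n]]]] //=; apply.
- apply/seteqP; split=> h /=; first by move=> ->; rewrite /koszul_d1 !lin_0.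
  by case=> *; exact: ex1.
- apply/seteqP; split=> [[h1 h2] [h _ [<- <-]] | [h1 h2] /subr0_eq /ex2 [h [? ?]]].
    by rewrite /koszul_d2 /= comm subrr.
  by exists h; rewrite // /koszul_d1; congr pair.
- apply/seteqP; split=> // f _; have [a [b abf]] := ex3 f.
  by exists (b, a).
Qed.

(** At the middle stage the preimage of [h1] under [T1] is the only candidate; its second component
    is checked after applying the injective [T1], which commutes with [T2]. *)
Lemma koszul_exact_bijl :
  injective T1 -> (forall f, exists x, T1 x = f) -> koszul_exact T1 T2.
Proof.
move=> inj surj; apply: koszul_exact_intro => [h h0 _|h1 h2 h12|f].
- by apply: inj; rewrite h0 lin_0.
- have [k kh1] := surj h1; exists k; split=> //.
  by apply: inj; rewrite comm kh1 h12.
- by have [a af] := surj f; exists a, 0; rewrite lin_0 // subr0.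
Qed.

Lemma koszul_exact_bijr :
  injective T2 -> (forall f, exists x, T2 x = f) -> koszul_exact T1 T2.
Proof.
move=> inj surj; apply: koszul_exact_intro => [h _ h0|h1 h2 h12|f].
- by apply: inj; rewrite h0 lin_0.
- have [k kh2] := surj h2; exists k; split=> //.
  by apply: inj; rewrite -comm kh2 h12.
- by have [b bf] := surj (- f); exists 0, b; rewrite lin_0 // bf opprK add0r.
Qed.

End KoszulComplex.

(** * Unit vectors and corrections of inner products *)

Lemma hnormalize x : x <> 0 -> exists a : R[i], hnorm (a *: x) = 1.
Proof.
move=> x0; have xn0 : hnorm x != 0 by apply/eqP => /hnorm_eq0.
have nR (r : R) : 0 <= r -> normc r%:C%C = r.
  by move=> r0; rewrite /= expr0n addr0 sqrtr_sqr ger0_norm.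
by exists (hnorm x)^-1%:C%C; rewrite hnormZ nR ?mulVf // invr_ge0 hnorm_ge0.
Qed.

(* The two candidates differ by [2 r u], so their products with [u] cannot both be
   smaller than [r] in modulus. *)
Lemma ip_away_from0 c u (r : R) : 0 <= r -> hnorm u = 1 ->
  exists c', hnorm (c' - c) <= r /\ r <= normc (ip c' u).
Proof.
move=> r0 u1.
have nr : normc r%:C%C = r by rewrite /= expr0n addr0 sqrtr_sqr ger0_norm.
have [rl|lr] := leP r (normc (ip (c + r%:C%C *: u) u)).
  by exists (c + r%:C%C *: u); rewrite addrC addKr hnormZ u1 mulr1 nr.
exists (c - r%:C%C *: u); rewrite addrC addKr hnormN hnormZ u1 mulr1 nr.
split=> //.
have := le_normcD (ip (c + r%:C%C *: u) u) (- ip (c - r%:C%C *: u) u).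
rewrite normcN -ipBl opprD opprK addrACA subrr add0r -scalerDl ipZl.
rewrite ip_hnorm u1 expr1n mulr1 -rmorphD.
by rewrite /= expr0n addr0 sqrtr_sqr ger0_norm ?addr_ge0 //; lra.
Qed.

(** * Commuting isometries with positive defect *)

Section CommutingIsometries.
Variables V1 V2 V1s V2s : H -> H.
Hypotheses (iso1 : isometry_op ip V1) (iso2 : isometry_op ip V2).
Hypothesis comm : forall x, V1 (V2 x) = V2 (V1 x).
Hypotheses (adj1 : is_adjoint ip V1 V1s) (adj2 : is_adjoint ip V2 V2s).

Let lin1 := isometry_linear iso1.
Let lin2 := isometry_linear iso2.
Let lin1s := adjoint_linear adj1.
Let lin2s := adjoint_linear adj2.

Lemma adjoint_comm x : V1s (V2s x) = V2s (V1s x).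
Proof. by apply: ip_inj => z; rewrite -adj1 -!adj2 -adj1 comm. Qed.

Lemma shift_comm w1 w2 x :
  shift V1 w1 (shift V2 w2 x) = shift V2 w2 (shift V1 w1 x).
Proof.
rewrite /shift (lin_B lin1) (lin_B lin2) (lin_Z lin1) (lin_Z lin2) comm.
rewrite !scalerBr !scalerA !opprB [w2 * w1]mulrC !addrA.
by rewrite [LHS]addrAC [X in X + _]addrAC [LHS]addrAC.
Qed.

Section PositiveDefect.
Hypothesis defect_ge0 : positive_op ip (defect V1 V2 V1s V2s).

(* Positivity of the defect at [V2 x] reads [- ||V1* V2 x||^2 >= 0] when [V1* x = 0];
   the range of [V1] is covered by commutativity. *)
Lemma defect_ge0_doubly_commuting x : V1s (V2 x) = V2 (V1s x).
Proof.
have kerP y : V1s y = 0 -> V1s (V2 y) = 0.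
  move=> y0; apply: ip_eq0; apply/le_anti; rewrite ip_ge0 andbT.
  have := defect_ge0 (V2 y); rewrite /defect (isometry_adjointK iso2 adj2).
  rewrite -adjoint_comm (isometry_adjointK iso2 adj2) y0.
  rewrite (lin_0 lin2) (lin_0 lin1) addr0 addrAC subrr add0r ipNl.
  by rewrite adj1 oppr_ge0.
have [y0 z] : V1s (x - V1 (V1s x)) = 0 /\ x = (x - V1 (V1s x)) + V1 (V1s x).
  by rewrite (lin_B lin1s) (isometry_adjointK iso1 adj1) subrr subrK.
rewrite {1}z (lin_D lin2) (lin_D lin1s) kerP // add0r -comm.
by rewrite (isometry_adjointK iso1 adj1).
Qed.

(** This is the adjoint of the preceding identity. *)
Lemma defect_ge0_doubly_commuting_sym x : V2s (V1 x) = V1 (V2s x).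
Proof.
apply: ip_inj => z; rewrite -adj2 -(adjoint_sym _ _ adj1).
by rewrite defect_ge0_doubly_commuting adj2 (adjoint_sym _ _ adj1).
Qed.

(** Double commutation turns the defect into the product of the commuting projections [1 - V1 V1s]
    and [1 - V2 V2s] onto the kernels of [V1s] and [V2s]. *)
Lemma defect_kernel x : V1s (defect V1 V2 V1s V2s x) = 0 /\
  V2s (defect V1 V2 V1s V2s x) = 0.
Proof.
rewrite /defect; split.
  rewrite (lin_D lin1s) !(lin_B lin1s) !(isometry_adjointK iso1 adj1) subrr sub0r.
  by rewrite defect_ge0_doubly_commuting adjoint_comm addNr.
rewrite (lin_D lin2s) !(lin_B lin2s) !defect_ge0_doubly_commuting_sym.
by rewrite !(isometry_adjointK iso2 adj2) [X in X + _]addrAC subrr sub0r addNr.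
Qed.

Lemma doubly_commuting_joint_eigenvalue w :
  (exists x, defect V1 V2 V1s V2s x <> 0) ->
  open_bidisk w -> joint_eigenvalue V1s V2s w.
Proof.
case=> x0; have [] := defect_kernel x0.
set e := defect _ _ _ _ x0 => e1 e2 e0; case: w => w1 w2 /= [].
rewrite /= !normC_lt1 => w11 w21.
have [y yE] := isometry_fixed_point iso2 e w21.
(* Applying [V1s] to the equation of [y] kills [e] and leaves [V1s y = w2 *: V2 (V1s y)]. *)
have y1 : V1s y = 0.
  apply: (isometry_fixed_eq0 iso2 w21).
  by rewrite {1}yE (lin_D lin1s) (lin_Z lin1s) e1 add0r defect_ge0_doubly_commuting.
have y2 : V2s y = w2 *: y.
  by rewrite {1}yE (lin_D lin2s) (lin_Z lin2s) e2 add0r (isometry_adjointK iso2 adj2).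
have [x xE] := isometry_fixed_point iso1 y w11.
have x1 : V1s x = w1 *: x.
  by rewrite {1}xE (lin_D lin1s) (lin_Z lin1s) y1 add0r (isometry_adjointK iso1 adj1).
exists x; split; first move=> x00; last split=> //=.
  move: xE; rewrite x00 (lin_0 lin1) scaler0 addr0 => y0.
  by apply: e0; move: yE; rewrite -y0 (lin_0 lin2) scaler0 addr0.
(* Both [V2s x] and [w2 *: x] solve [z = w2 *: y + w1 *: V1 z], so their difference is a fixed point
   of [w1 V1]. *)
apply/subr0_eq/(isometry_fixed_eq0 iso1 w11).
rewrite (lin_B lin1) -defect_ge0_doubly_commuting_sym scalerBr (lin_Z lin1).
rewrite {1}xE {2}xE (lin_D lin2s) y2 (lin_Z lin2s) scalerDr opprD addrACA subrr.
by rewrite add0r !scalerA [w2 * w1]mulrC.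
Qed.

(* Gliding hump: [u k] is a unit joint eigenvector at the point [(1 - 4^-k) w^*].
   Every vector in the range of the last Koszul map of [(V1 - w1, V2 - w2)] has
   inner product [O(4^-k)] with [u k], while a series of corrections of size [3^-k]
   produces a vector whose inner product with [u k] is at least [3^-k / 2]. *)
Lemma koszul_breaks_closed_bidisk w :
  (exists x, defect V1 V2 V1s V2s x <> 0) ->
  closed_bidisk w -> koszul_breaks_at (shift V1 w.1) (shift V2 w.2) 3.
Proof.
move=> Cn0; case: w => w1 w2 [] /=; rewrite !normC_le1 => w11 w21 surj.
have t01 k : 0 <= 1 - (4^-1 : R) ^+ k < 1.
  have : 0 < (4^-1 : R) ^+ k by rewrite exprn_gt0 // invr_gt0.
  have : (4^-1 : R) ^+ k <= 1 by apply: exprn_ile1; lra.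
  by lra.
(* The factor [t k < 1] moves boundary points of the bidisk inside, where joint eigenvectors
   exist. *)
pose t k := (1 - 4^-1 ^+ k)%:C%C : R[i].
have nt k : normc (t k) < 1.
  rewrite /t /= expr0n addr0 sqrtr_sqr.
  by have /andP[t0 t1] := t01 k; rewrite ger0_norm.
have nJ (z : R[i]) : normc z^* = normc z.
  by apply: complexI; rewrite -!normC_normc norm_conjC.
have tw k (z : R[i]) : normc z <= 1 -> normc (t k * z^*) < 1.
  move=> z1; rewrite normcM nJ; apply: le_lt_trans (nt k).
  by rewrite ler_piMr // normc_ge0.
have /choice[u uP] k : exists x, [/\ hnorm x = 1,
    V1s x = (t k * w1^*) *: x & V2s x = (t k * w2^*) *: x].
  have [|x [x0 [/= x1 x2]]] :=
      @doubly_commuting_joint_eigenvalue (t k * w1^*, t k * w2^*) Cn0.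
    by split; rewrite normC_lt1 tw.
  have [a ax] := hnormalize x0; exists (a *: x); split=> //.
    by rewrite (lin_Z lin1s) x1 !scalerA mulrC.
  by rewrite (lin_Z lin2s) x2 !scalerA mulrC.
(* Pairing the index with the current approximation allows a single choice function, so that
   [c k.+1] is [g (k, c k)]. *)
have /choice[g gP] (kc : nat * H) : exists c', hnorm (c' - kc.2) <= 3^-1 ^+ kc.1 /\
    3^-1 ^+ kc.1 <= normc (ip c' (u kc.1)).
  by case: (uP kc.1) => u1 _ _; apply: ip_away_from0 => //; rewrite exprn_ge0 // invr_ge0.
pose c n := iteri n (fun k x => g (k, x)) 0.
have c_geo n : hnorm (c n.+1 - c n) <= 1 * 3^-1 ^+ n.
  by rewrite mul1r; case: (gP (n, c n)).
have [|l lc] := geometric_cvg (r := 3^-1) _ c_geo; first by lra.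
(* The later corrections move [c k.+1] by at most [3^-1 ^+ k.+1 / (1 - 3^-1)], which is half of
   [3^-1 ^+ k]; the other half survives in the limit. *)
have lu k : 2^-1 * 3^-1 ^+ k <= normc (ip l (u k)).
  case: (uP k) => u1 _ _.
  have : 3^-1 ^+ k <= normc (ip (c k.+1) (u k)) by case: (gP (k, c k)).
  have := le_normcD (ip l (u k)) (ip (c k.+1 - l) (u k)).
  rewrite -ipDl addrCA subrr addr0.
  have := cauchy_schwarz (c k.+1 - l) (u k); rewrite u1 mulr1 hnormB.
  have := lc k.+1; rewrite exprS; move: (3^-1 ^+ k) => r.
  by rewrite (_ : 1 / _ * _ = 2^-1 * r); [lra|field].
have shift_le T Ts z a k : is_adjoint ip T Ts -> normc z <= 1 ->
    Ts (u k) = (t k * z^*) *: u k ->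
    normc (ip (shift T z a) (u k)) <= 4^-1 ^+ k * hnorm a.
  move=> adj z1 ue; case: (uP k) => u1 _ _.
  have tJ : (t k)^* = t k by apply: conj_Creal; rewrite complex_real.
  (* Moving [T] to the eigenvector yields the factor [t k * z], from which the shift subtracts
     [z]. *)
  have -> : ip (shift T z a) (u k) = (t k - 1) * (z * ip a (u k)).
    by rewrite /shift ipBl ipZl adj ue ipZr rmorphM /= conjCK tJ; ring.
  have -> : t k - 1 = - (4^-1 ^+ k)%:C%C by rewrite /t rmorphB /= addrAC subrr add0r.
  rewrite normcM normcN.
  have -> : normc (4^-1 ^+ k)%:C%C = 4^-1 ^+ k :> R.
    by rewrite /= expr0n addr0 sqrtr_sqr ger0_norm // exprn_ge0 // invr_ge0.
  rewrite ler_wpM2l ?exprn_ge0 ?invr_ge0 // normcM.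
  have := cauchy_schwarz a (u k); rewrite u1 mulr1; apply: le_trans.
  by rewrite ler_piMl // normc_ge0.
have [[b a] _ /= lE] : range (koszul_d2 (shift V1 w1) (shift V2 w2)) l by rewrite surj.
set K := hnorm a + hnorm b.
have lu4 k : normc (ip l (u k)) <= K * 4^-1 ^+ k.
  case: (uP k) => _ ue1 ue2; rewrite -lE /koszul_d2 /= ipBl.
  apply: le_trans (le_normcD _ _) _; rewrite normcN mulrC mulrDr.
  by rewrite lerD //; [exact: (shift_le V1 V1s) | exact: (shift_le V2 V2s)].
have K0 : 0 <= K by rewrite addr_ge0 ?hnorm_ge0.
(* Since [4^-1 = 3 / 4 * 3^-1], the two bounds would give [2^-1 <= K * (3 / 4) ^+ N], which fails
   for large [N]. *)
have [||N /(_ N (leqnn N))] := @geometric_lt R K (3 / 4) 2^-1 K0; [lra|lra|].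
have := le_trans (lu N) (lu4 N).
have -> : 4^-1 ^+ N = (3 / 4) ^+ N * 3^-1 ^+ N :> R.
  by rewrite -exprMn; congr (_ ^+ N); field.
by rewrite mulrA leNgt => /negP nlt Klt; apply: nlt; rewrite ltr_pM2r ?exprn_gt0 ?invr_gt0.
Qed.

Lemma taylor_spectrum_sub_closed_bidisk :
  taylor_spectrum V1 V2 `<=` @closed_bidisk R.
Proof.
move=> [w1 w2] /= sp; split; rewrite /= normC_le1 leNgt; apply/negP => w_gt1; apply: sp.
  have [inj surj] := shift_isometry_bij iso1 w_gt1.
  apply: koszul_exact_bijl => //; [exact: shift_linear..|exact: shift_comm].
have [inj surj] := shift_isometry_bij iso2 w_gt1.
apply: koszul_exact_bijr => //; [exact: shift_linear..|exact: shift_comm].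
Qed.

End PositiveDefect.
End CommutingIsometries.
End Hilbert.

Theorem theorem4p11 (R : realType) (H : lmodType R[i]) (ip : H -> H -> R[i])
    (V1 V2 V1s V2s : H -> H) :
  hilbert_space ip ->
  isometry_op ip V1 -> isometry_op ip V2 ->
  (forall x, V1 (V2 x) = V2 (V1 x)) ->
  is_adjoint ip V1 V1s -> is_adjoint ip V2 V2s ->
  positive_op ip (defect V1 V2 V1s V2s) ->
  (exists x, defect V1 V2 V1s V2s x <> 0) ->
  [/\ taylor_spectrum V1 V2 = @closed_bidisk R,
      (forall w, @open_bidisk R w -> joint_eigenvalue V1s V2s w) &
      (forall w, @open_bidisk R w ->
         koszul_breaks_at (shift V1 w.1) (shift V2 w.2) 3)].
Proof.
move=> hilb iso1 iso2 comm adj1 adj2 Cge0 Cn0.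
have breaks3 := koszul_breaks_closed_bidisk hilb iso1 iso2 comm adj1 adj2 Cge0 Cn0.
split.
- apply/seteqP; split=> [|w ww]; first exact: (taylor_spectrum_sub_closed_bidisk hilb).
  by move=> /(_ 3%N); apply; apply: breaks3.
- move=> w; exact: (doubly_commuting_joint_eigenvalue hilb iso1 iso2 comm adj1 adj2 Cge0).
- by move=> w [w1 w2]; apply: breaks3; split; exact: ltW.
Qed.
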